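(* Let $\{q_k:k\in\mathbb{N}\}$ be a convex and non-increasing sequence of nonnegative real numbers, let $\{\alpha_k: k\in\mathbb{N}\}$ be any sequence of positive integers, and let $x\in I_2(e_0+e_1)$, i.e. $x\in G$ with $x_0=x_1=1$. Then for every $k\in\mathbb{N}$, $$\left\vert\sum_{j=2^{2\alpha_k}}^{2^{2\alpha_k+1}}q_{2^{2\alpha_k+1}-j}\,D_j(x)\right\vert\geq q_1-\frac{3}{2}q_3 .$$
   Context: $\mathbb{N}=\{0,1,2,\dots\}$. $G=\prod_{j=0}^{\infty}\mathbb{Z}_2$ is the group of sequences $x=(x_0,x_1,\dots)$, $x_j\in\{0,1\}$, with coordinatewise addition mod 2. $e_n\in G$ is the sequence with $1$ in position $n$ and $0$ elsewhere, and $I_n(x)=\{y\in G:y_0=x_0,\dots,y_{n-1}=x_{n-1}\}$. For $n=\sum_j n_j2^j$ with $n_j\in\{0,1\}$, the Walsh functions are $w_n(x)=\prod_{k=0}^\infty(-1)^{n_kx_k}$, and the Dirichlet kernels are $D_n=\sum_{k=0}^{n-1}w_k$ for $n\ge1$. A sequence $\{q_k\}$ is convex if $q_{n-1}+q_{n+1}-2q_n\ge0$ for all $n\ge1$. *)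

(* Defs.v *)
From HB Require Import structures.
From mathcomp Require Import all_boot all_order all_algebra.
From mathcomp Require Import all_classical all_reals all_analysis.

Set Implicit Arguments.
Unset Strict Implicit.
Unset Printing Implicit Defensive.

Import Order.TTheory GRing.Theory Num.Theory.

Local Open Scope classical_set_scope.
Local Open Scope ring_scope.

(* The group law is the pointwise one that functions into a zmodType carry. *)
Definition walsh_group : zmodType := nat -> 'Z_2.

Definition unit_seq (n : nat) : walsh_group := fun k => (k == n)%:R.

Definition dyadic_interval (n : nat) (x : walsh_group) : set walsh_group :=
  [set y | forall j, (j < n)%N -> y j = x j].

Definition bit (n j : nat) : nat := (n %/ 2 ^ j) %% 2.

Lemma bit_small (n j : nat) : (n <= j)%N -> bit n j = 0%N.
Proof.
move=> le_nj; rewrite /bit divn_small ?mod0n //.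
by apply: leq_ltn_trans le_nj _; exact: ltn_expl.
Qed.

Lemma sum_bit (n : nat) : n = (\sum_(j < n) bit n j * 2 ^ j)%N.
Proof.
suff H m : (n < 2 ^ m)%N -> n = (\sum_(j < m) bit n j * 2 ^ j)%N.
  by apply: H; exact: ltn_expl.
move=> lt_n; suff -> : (\sum_(j < m) bit n j * 2 ^ j)%N = (n %% 2 ^ m)%N.
  by rewrite modn_small.
elim: m {lt_n} => [|m IHm]; first by rewrite big_ord0 modn1.
rewrite big_ord_recr /= IHm /bit [in RHS](divn_eq n (2 ^ m)).
rewrite [in RHS](divn_eq (n %/ 2 ^ m) 2) mulnDl -mulnA -expnS -addnA modnMDl.
rewrite [LHS]addnC [RHS]modn_small // expnS mul2n -addnn.
have lt_r : (n %% 2 ^ m < 2 ^ m)%N by rewrite ltn_mod expn_gt0.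
have : (n %/ 2 ^ m %% 2 < 2)%N by rewrite ltn_mod.
case: (n %/ 2 ^ m %% 2)%N => [|[|//]] _.
  by rewrite mul0n add0n ltn_addr.
by rewrite mul1n ltn_add2l.
Qed.

(* The infinite product over k is cut at k < n: all later bits of n vanish,
   see walsh_widen. *)
Definition walsh {R : realType} (n : nat) (x : walsh_group) : R :=
  \prod_(k < n) (-1) ^+ (bit n k * x k)%N.

Lemma walsh_widen (R : realType) (m n : nat) (x : walsh_group) :
  (n <= m)%N -> walsh n x = \prod_(k < m) (-1) ^+ (bit n k * x k)%N :> R.
Proof.
move=> /subnKC <-; rewrite big_split_ord /= [X in _ * X]big1 ?mulr1 // => k _.
by rewrite bit_small ?mul0n ?expr0 // leq_addr.
Qed.

Definition dirichlet {R : realType} (n : nat) (x : walsh_group) : R :=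
  \sum_(k < n) walsh k x.

Definition convex_seq {R : realType} (q : R^nat) : Prop :=
  forall n, (1 <= n)%N -> 0 <= q n.-1 + q n.+1 - 2 * q n.

(* Main.v *)
(* As x_0 = x_1 = 1, the kernels D_j(x) vanish for even j, while D_(4m+1)(x) and
   D_(4m+3)(x) are opposite signs. Read downwards from the top index, the sum is
   therefore a signed sum of the d_k = q_(4k+1) - q_(4k+3), k = 0, 1, ..., up to a
   global sign. Convexity gives d_k <= (q_(4k-1) - q_(4k+3)) / 2 for k >= 1, so the
   terms after d_0 = q_1 - q_3 telescope to at most q_3 / 2 in absolute value. *)
Require Import Defs.
From HB Require Import structures.
From mathcomp Require Import all_boot all_order all_algebra.
From mathcomp Require Import all_classical all_reals all_analysis.
From mathcomp Require Import zify ring lra.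

Set Implicit Arguments.
Unset Strict Implicit.
Unset Printing Implicit Defensive.

Import Order.TTheory GRing.Theory Num.Theory.

Local Open Scope classical_set_scope.
Local Open Scope ring_scope.

Lemma bit_double0 (b : bool) (n : nat) : bit (b + n.*2) 0 = b.
Proof. by rewrite /bit expn0 divn1 -muln2 addnC modnMDl modn_small; case: b. Qed.

Lemma bit_doubleS (b : bool) (n k : nat) : bit (b + n.*2) k.+1 = bit n k.
Proof.
by rewrite /bit expnS divnMA -muln2 addnC divnMDl // [(_ %/ 2)%N]divn_small ?addn0;
  case: b.
Qed.

(** The lowest binary digit of the index meets only [x 0]; the remaining digits are those of [n] and
    meet the shifted sequence. *)
Lemma walsh_double (R : realType) (b : bool) (n : nat) (x : walsh_group) :
  walsh (b + n.*2) x =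
  (-1) ^+ (b * x 0%N)%N * walsh n (fun k => x k.+1) :> R.
Proof.
have le_m : (b + n.*2 <= (b + n.*2).+1)%N by [].
rewrite (walsh_widen R x le_m) big_ord_recl bit_double0; congr (_ * _).
rewrite (@walsh_widen R (b + n.*2)); last by rewrite -addnn addnA leq_addl.
by apply: eq_bigr => k _; rewrite -(bit_doubleS b n k).
Qed.

Lemma normr_walsh (R : realType) (n : nat) (x : walsh_group) :
  `|walsh n x : R| = 1.
Proof.
by rewrite normr_prod big1 // => k _; rewrite normrX normrN1 expr1n.
Qed.

Lemma walsh_even (R : realType) (n : nat) (x : walsh_group) :
  walsh n.*2 x = walsh n (fun k => x k.+1) :> R.
Proof. by have := walsh_double R false n x; rewrite mul0n mul1r. Qed.

Lemma walsh_odd (R : realType) (n : nat) (x : walsh_group) :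
  x 0%N = 1 -> walsh n.*2.+1 x = - walsh n (fun k => x k.+1) :> R.
Proof. by move=> x0; have := walsh_double R true n x; rewrite x0 mulN1r. Qed.

Lemma dirichletS (R : realType) (n : nat) (x : walsh_group) :
  dirichlet n.+1 x = dirichlet n x + walsh n x :> R.
Proof. exact: big_ord_recr. Qed.

(** The Walsh functions of indices [n.*2] and [n.*2.+1] differ only in the factor [(-1) ^+ x 0], so
    they cancel in pairs. *)
Lemma dirichlet_even (R : realType) (n : nat) (x : walsh_group) :
  x 0%N = 1 -> dirichlet n.*2 x = 0 :> R.
Proof.
move=> x0; elim: n => [|n IHn]; first exact: big_ord0.
by rewrite doubleS !dirichletS IHn walsh_odd // walsh_even add0r subrr.
Qed.

Lemma dirichlet_odd (R : realType) (n : nat) (x : walsh_group) :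
  x 0%N = 1 -> dirichlet n.*2.+1 x = walsh n (fun k => x k.+1) :> R.
Proof. by move=> x0; rewrite dirichletS dirichlet_even // walsh_even add0r. Qed.

(** The block of four added here has kernel indices 4m+3, 4m+2, 4m+1, 4m with m = L - n - 1. Peeling
    two binary digits turns both odd kernels into the same Walsh value up to sign. *)
Lemma sum_dirichlet_rec (R : realType) (q : R^nat) (x : walsh_group)
    (L n : nat) :
  x 0%N = 1 -> x 1%N = 1 -> (n < L)%N ->
  \sum_(i < (4 * n.+1).+1) q i * dirichlet (4 * L - i) x =
  \sum_(i < (4 * n).+1) q i * dirichlet (4 * L - i) x
  - walsh (L - n.+1) (fun k => x k.+2) * (q (4 * n + 1)%N - q (4 * n + 3)%N).
Proof.
move=> x0 x1 ltnL; pose m := (L - n.+1)%N.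
have -> : (4 * n.+1 = (4 * n).+4)%N by lia.
rewrite 4!big_ord_recr /=.
have -> : (4 * L - (4 * n).+1 = (m.*2.+1).*2.+1)%N by lia.
have -> : (4 * L - (4 * n).+2 = (m.*2.+1).*2)%N by lia.
have -> : (4 * L - (4 * n).+3 = (m.*2).*2.+1)%N by lia.
have -> : (4 * L - (4 * n).+4 = (m.*2).*2)%N by lia.
rewrite !dirichlet_even // !dirichlet_odd // walsh_odd // walsh_even.
by rewrite addn1 addn3 -/m; ring.
Qed.

(** By convexity the successive drops [q i - q i.+1] decrease, so the last two of four drops make up
    at most half of their total. *)
Lemma convex_seq_gap (R : realType) (q : R^nat) (n : nat) :
  convex_seq q -> q (n + 2)%N - q (n + 4)%N <= (q n - q (n + 4)%N) / 2.
Proof.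
move=> cvx.
have := cvx n.+1 isT; have := cvx n.+2 isT; have := cvx n.+3 isT.
rewrite !addnS addn0 /=; lra.
Qed.

(** Keeping [q (4 * n + 3)] in the bound makes the induction telescope. *)
Lemma sum_dirichlet_ge (R : realType) (q : R^nat) (x : walsh_group)
    (L n : nat) :
  nonincreasing_seq q -> convex_seq q -> x 0%N = 1 -> x 1%N = 1 ->
  (n < L)%N ->
  q 1%N - q 3%N - (q 3%N - q (4 * n + 3)%N) / 2 <=
  `| \sum_(i < (4 * n.+1).+1) q i * dirichlet (4 * L - i) x |.
Proof.
move=> q_noninc cvx x0 x1; elim: n => [|n IHn] ltnL.
  rewrite sum_dirichlet_rec // big_ord1 subn0.
  (* The term [i = 0] vanishes, which leaves the first block alone. *)
  have -> : (4 * L = L.*2.*2)%N by lia.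
  rewrite dirichlet_even // mulr0 add0r normrN normrM normr_walsh mul1r.
  by rewrite muln0 !add0n subrr mul0r subr0 ler_norm.
rewrite sum_dirichlet_rec //.
(* The signs of the blocks are not tracked: each later block is subtracted at its full absolute
   value. *)
apply: le_trans (lerB_dist _ _).
have {IHn} := IHn (ltnW ltnL).
have := convex_seq_gap (4 * n + 3) cvx.
rewrite normrM normr_walsh mul1r ger0_norm ?subr_ge0; last by apply: q_noninc; lia.
have -> : (4 * n + 3 + 2 = 4 * n.+1 + 1)%N by lia.
have -> : (4 * n + 3 + 4 = 4 * n.+1 + 3)%N by lia.
lra.
Qed.

Theorem lemma2 (R : realType) (q : R^nat) (alpha : nat -> nat)
    (x : walsh_group)
    (q_ge0 : forall k, 0 <= q k)
    (q_noninc : nonincreasing_seq q)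
    (q_convex : convex_seq q)
    (alpha_gt0 : forall k, (0 < alpha k)%N)
    (hx : x \in dyadic_interval 2 (unit_seq 0 + unit_seq 1)) :
  forall k : nat,
    q 1%N - 3 / 2 * q 3%N <=
    `| \sum_(2 ^ (2 * alpha k) <= j < (2 ^ (2 * alpha k + 1)).+1)
         q (2 ^ (2 * alpha k + 1) - j)%N * dirichlet j x |.
Proof.
move=> k.
have [x0 x1] : x 0%N = 1 /\ x 1%N = 1.
  by have hx' := set_mem hx; rewrite !hx'; split; apply: val_inj.
(* Since [alpha k] is positive, both endpoints are multiples of 4, so after the top index the range
   splits into [n.+1 = 4 ^ a] full blocks. *)
have [a ea] : exists a, alpha k = a.+1 by exists (alpha k).-1; rewrite prednK.
have [n en] : exists n, (2 ^ (2 * a) = n.+1)%N.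
  by exists (2 ^ (2 * a)).-1; rewrite prednK ?expn_gt0.
have -> : (2 ^ (2 * alpha k) = 4 * n.+1)%N by rewrite ea mulnS expnD en.
have -> : (2 ^ (2 * alpha k + 1) = 4 * n.+1.*2)%N.
  by rewrite ea mulnS addn1 expnS expnD en; lia.
(* Reindex by the distance [i] from the top index, with [L = n.+1.*2]. *)
rewrite big_nat_rev /= -{1}[(4 * n.+1)%N]add0n big_addn big_mkord.
have -> : ((4 * n.+1.*2).+1 - 4 * n.+1 = (4 * n.+1).+1)%N by lia.
rewrite (eq_bigr (fun i : 'I__ => q i * dirichlet (4 * n.+1.*2 - i) x)).
  have ltn : (n < n.+1.*2)%N by lia.
  apply: le_trans (sum_dirichlet_ge q_noninc q_convex x0 x1 ltn).
  (* Dropping the leftover [q (4 * n + 3) / 2] gives the constant 3/2. *)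
  by have := q_ge0 (4 * n + 3)%N; lra.
move=> i _; have ltni := ltn_ord i.
by congr (q _ * dirichlet _ x); lia.
Qed.
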